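(* Let $A,B\in M_{d}^{+}$, $X\in M_{d}$, let $|||\cdot|||$ be any unitarily invariant norm on $M_d$, and let $N$ be a nonnegative integer. Let $t>0$ and put $f(u)=|||\,|A^{u}XB^{u}|^{t}|||\cdot|||\,|A^{-u}XB^{-u}|^{t}|||$ for $u\in[-1,1]$. If $-1\leq v\leq1$, then $$|||\,|A^{v}XB^{v}|^{t}|||\cdot|||\,|A^{-v}XB^{-v}|^{t}|||\ \leq\ |||\,|AXB|^{t}|||\cdot|||\,|A^{-1}XB^{-1}|^{t}|||-\sum_{n=0}^{N-1}s_{n}(v)\sum_{k=1}^{2^{n}}\delta_{n,k}\,\chi_{\left(\frac{k-1}{2^{n-1}}-1,\ \frac{k}{2^{n-1}}-1\right)}(v),$$ where $s_{n}(v)=r_{n}\left(\frac{v+1}{2}\right)$ and $$\delta_{n,k}=f\left(\tfrac{k-1}{2^{n-1}}-1\right)+f\left(\tfrac{k}{2^{n-1}}-1\right)-2f\left(\tfrac{2k-1}{2^{n}}-1\right).$$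
   Context: $M_d$ is the set of $d\times d$ complex matrices and $M_d^+$ the subset of positive definite ones. For $Y\in M_d$, $|Y|=(Y^*Y)^{1/2}$. The functions $r_n:[0,1]\to\mathbb{R}$ are defined recursively by $r_0(v)=\min\{v,1-v\}$ and $r_n(v)=\min\{2r_{n-1}(v),1-2r_{n-1}(v)\}$ for $n\ge 1$. $\chi_I$ is the characteristic function of the interval $I$. A sum $\sum_{n=0}^{N-1}$ is zero when $N=0$. *)

(* Defs.v *)
From HB Require Import structures.
From mathcomp Require Import all_boot all_order all_algebra.
From mathcomp Require Import complex.
From mathcomp Require Import all_classical all_reals all_analysis.

Set Implicit Arguments.
Unset Strict Implicit.
Unset Printing Implicit Defensive.

Import Order.TTheory GRing.Theory Num.Theory.
Local Open Scope complex_scope.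
Local Open Scope ring_scope.

(* [0 < z] in [R[i]] entails that [z] is real. *)
Definition posdefmx (R : realType) (d : nat) (A : 'M[R[i]]_d) : Prop :=
  A \is hermsymmx /\
  forall x : 'cV[R[i]]_d, x != 0 -> 0 < ((x ^t* )%sesqui *m A *m x) 0 0.

(* Functional calculus [g(A)], through the spectral decomposition
   [A = P^-1 *m diag *m P] with [P] unitary; meant for Hermitian [A], whose
   eigenvalues are real, so that taking real parts loses nothing. *)
Definition mxfun (R : realType) (d : nat) (g : R -> R) (A : 'M[R[i]]_d) :
  'M[R[i]]_d :=
  invmx (spectralmx A)
  *m diag_mx (\row_i (g (complex.Re (spectral_diag A 0 i)))%:C)
  *m spectralmx A.

(* Meant for positive definite [A], or for positive semidefinite [A] when
   [0 < u] (recall that [0 `^ u = 0] then). *)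
Definition mxpow (R : realType) (d : nat) (A : 'M[R[i]]_d) (u : R) :
  'M[R[i]]_d := mxfun (fun x => x `^ u) A.

Definition mxabs (R : realType) (d : nat) (Y : 'M[R[i]]_d) : 'M[R[i]]_d :=
  mxpow ((Y ^t* )%sesqui *m Y) 2^-1.

Record unitarily_invariant_norm (R : realType) (d : nat)
    (nrm : 'M[R[i]]_d -> R) : Prop := UnitarilyInvariantNorm {
  uinorm_ge0 : forall Y, 0 <= nrm Y;
  uinorm_eq0 : forall Y, nrm Y = 0 -> Y = 0;
  uinormZ : forall (a : R[i]) Y, (nrm (a *: Y))%:C = `|a| * (nrm Y)%:C;
  uinormD : forall Y Z, nrm (Y + Z) <= nrm Y + nrm Z;
  uinormU : forall U V Y, U \is unitarymx -> V \is unitarymx ->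
    nrm (U *m Y *m V) = nrm Y }.

Fixpoint r_ (R : realType) (n : nat) (v : R) : R :=
  if n is m.+1 then Num.min (2 * r_ m v) (1 - 2 * r_ m v)
  else Num.min v (1 - v).

Definition s_ (R : realType) (n : nat) (v : R) : R := r_ n ((v + 1) / 2).

(* The exponent [n%:Z - 1] is an integer, equal to [-1] for [n = 0]. *)
Definition dyadic (R : realType) (n k : nat) : R :=
  k%:R / 2 ^ (n%:Z - 1) - 1.

(* Meant for [1 <= k]. *)
Definition delta_ (R : realType) (f : R -> R) (n k : nat) : R :=
  f (dyadic R n k.-1) + f (dyadic R n k)
  - 2 * f ((2 * k%:R - 1) / 2 ^+ n - 1).

(* Main.v *)
Require Import Defs.
From HB Require Import structures.
From mathcomp Require Import all_boot all_order fingroup perm all_algebra.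
From mathcomp Require Import complex.
From mathcomp Require Import all_classical all_reals all_analysis.
From mathcomp Require Import ring lra.

Set Implicit Arguments.
Unset Strict Implicit.
Unset Printing Implicit Defensive.

Import Order.TTheory GRing.Theory Num.Theory Num.Def.
Local Open Scope complex_scope.
Local Open Scope ring_scope.

(** Put g u = ||| |A^u X B^u|^t |||, so that f u = g u * g (- u).  The function
g is midpoint log-convex and bounded on [-1, 1], hence so is the even function
f, which is therefore convex there.  The sum on the right-hand side is the gap
between the chord of f over [-1, 1] and the piecewise linear interpolation of f
at the dyadic points of level N, and a convex function lies below its chords.

Log-convexity of g.  With h half the distance between two exponents x and y, and
Y the matrix at their midpoint, the matrices at x and y are P = A^h Y B^h and
Q = A^-h Y B^-h, so the point is
||| |Y|^t |||^2 <= ||| |P|^t ||| * ||| |Q|^t |||.  Here P* Q B^h = B^h Y* Y,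
that is, P* Q is similar to Y* Y.  Compressing to the dominant k-dimensional
invariant subspace of Y* Y and comparing determinants, a Cauchy-Schwarz
inequality for Gram determinants ([det_gram_CauchySchwarz]) and a bound on
compressed determinants ([det_diag_compression]) show, for every k, that the
square of the product of the k largest eigenvalues of Y* Y is at most the
product of the k largest eigenvalues of P* P and of Q* Q
([singular_value_product]).

From eigenvalues to norms.  Restricted to real diagonal matrices the norm is a
symmetric gauge, monotone under weak log-majorization
([gauge_weak_log_majorization]) and subject to a Cauchy-Schwarz inequality
([gauge_CauchySchwarz]); raising the eigenvalues to the power t / 2 yields the
claim ([nrm_mxabs_pow_CauchySchwarz]).

From midpoints to all points.  Midpoint convexity together with boundedness
already gives convexity ([midconvex_bounded_le]), and refining the dyadic
subdivision once changes the interpolation by one tent function on each interval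
([dyadic_refinement]). *)

(** * Gram determinants and products of singular values *)

(** Sylvester's identity: the two sides are the determinants obtained by
eliminating either diagonal block of [[1, -A], [B, 1]]. *)
Lemma det_add1_mulmxC (K : comNzRingType) m n (A : 'M[K]_(m, n))
    (B : 'M[K]_(n, m)) :
  \det (1%:M + A *m B) = \det (1%:M + B *m A).
Proof.
have := congr1 determinant (erefl (block_mx 1%:M (- A) B 1%:M)).
have E1 : block_mx 1%:M (- A) B 1%:M =
    block_mx 1%:M 0 B 1%:M *m block_mx 1%:M (- A) 0 (1%:M + B *m A).
  rewrite mulmx_block !mul0mx !mulmx0 !mul1mx !mulmx1 !addr0 mulmxN.
  by rewrite addrCA addNr addr0.
have E2 : block_mx 1%:M (- A) B 1%:M =
    block_mx (1%:M + A *m B) (- A) 0 1%:M *m block_mx 1%:M 0 B 1%:M.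
  rewrite mulmx_block !mul0mx !mulmx0 !mul1mx !mulmx1 !add0r mulNmx.
  by rewrite -addrA subrr addr0.
rewrite {1}E1 E2 !det_mulmx !det_lblock !det_ublock !det1.
by rewrite !mul1r !mulr1.
Qed.

Section Gram.
Variable C : numClosedFieldType.
Local Open Scope sesquilinear_scope.

Lemma trmxC_mul m n p (A : 'M[C]_(m, n)) (B : 'M[C]_(n, p)) :
  (A *m B) ^t* = B ^t* *m A ^t*.
Proof. by rewrite trmx_mul map_mxM. Qed.

Lemma trmxC_add m n (A B : 'M[C]_(m, n)) : (A + B) ^t* = A ^t* + B ^t*.
Proof. by apply/matrixP=> i j; rewrite !mxE rmorphD. Qed.

Lemma trmxC1 n : (1%:M : 'M[C]_n) ^t* = 1%:M.
Proof. by rewrite trmx1 map_mx1. Qed.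

Lemma trmxC_diag n (a : 'rV[C]_n) : (diag_mx a) ^t* = diag_mx (map_mx conjC a).
Proof. by rewrite tr_diag_mx map_diag_mx. Qed.

Lemma trmxC_invmx n (A : 'M[C]_n) : (invmx A) ^t* = invmx (A ^t*).
Proof. by rewrite trmx_inv map_invmx. Qed.

Lemma gram_hermitian m n (K : 'M[C]_(m, n)) : (K ^t* *m K) ^t* = K ^t* *m K.
Proof. by rewrite trmxC_mul trmxCK. Qed.

Lemma hermsymmxP n (A : 'M[C]_n) : reflect (A ^t* = A) (A \is hermsymmx).
Proof.
apply: (iffP (is_hermitianmxP _ _ _)) => [{2}->|E]; first by rewrite scale1r.
by rewrite scale1r E.
Qed.

Lemma gram_diagE m n (K : 'M[C]_(m, n)) i :
  (K ^t* *m K) i i = \sum_j `|K j i| ^+ 2.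
Proof.
by rewrite mxE; apply: eq_bigr => j _; rewrite !mxE mulrC -normCK.
Qed.

Lemma gram_diag_ge0 m n (K : 'M[C]_(m, n)) i : 0 <= (K ^t* *m K) i i.
Proof. by rewrite gram_diagE sumr_ge0 // => j _; rewrite exprn_ge0. Qed.

Lemma gram_eq0 m n (K : 'M[C]_(m, n)) : K ^t* *m K = 0 -> K = 0.
Proof.
move=> K0; apply/matrixP=> j i; rewrite mxE.
have /eqP := congr1 (fun M : 'M[C]_n => M i i) K0; rewrite gram_diagE mxE.
rewrite psumr_eq0 => [/allP/(_ j (mem_index_enum _))|k _]; last first.
  exact: exprn_ge0.
by rewrite /= expf_eq0 /= normr_eq0 => /eqP.
Qed.

Lemma spectral_decomp n (A : 'M[C]_n) : A ^t* = A ->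
  A = (spectralmx A) ^t* *m diag_mx (spectral_diag A) *m spectralmx A.
Proof.
move=> /hermsymmxP/hermitian_normalmx/orthomx_spectralP {1}->.
by rewrite invmx_unitary // spectral_unitarymx.
Qed.

Lemma spectral_diagE n (A : 'M[C]_n) : A ^t* = A ->
  diag_mx (spectral_diag A) = spectralmx A *m A *m (spectralmx A) ^t*.
Proof.
move=> hA; have uA := spectral_unitarymx A.
rewrite {3}(spectral_decomp hA) !mulmxA (unitarymxP uA) mul1mx.
by rewrite -mulmxA (unitarymxP uA) mulmx1.
Qed.

(** In its own eigenbasis a Gram matrix is again a Gram matrix, so its
eigenvalues appear as diagonal entries, which are sums of squared moduli. *)
Lemma gram_spectral_ge0 m n (K : 'M[C]_(m, n)) i :
  0 <= spectral_diag (K ^t* *m K) 0 i.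
Proof.
have /matrixP/(_ i i) := spectral_diagE (gram_hermitian K).
rewrite mxE eqxx mulr1n => ->; set P := spectralmx _.
have -> : P *m (K ^t* *m K) *m P ^t* = (K *m P ^t*) ^t* *m (K *m P ^t*).
  by rewrite trmxC_mul trmxCK !mulmxA.
exact: gram_diag_ge0.
Qed.

Lemma det_add1_hermitian n (A : 'M[C]_n) : A ^t* = A ->
  \det (1%:M + A) = \prod_i (1 + spectral_diag A 0 i).
Proof.
move=> hA; have uA := spectral_unitarymx A.
rewrite {1}(spectral_decomp hA) -mulmxA det_add1_mulmxC -mulmxA.
rewrite (unitarymxP uA) mulmx1 -diag_const_mx -linearD /= det_diag.
by apply: eq_bigr => i _; rewrite !mxE.
Qed.

Lemma det_gram_ge0 m n (K : 'M[C]_(m, n)) : 0 <= \det (K ^t* *m K).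
Proof.
rewrite (spectral_decomp (gram_hermitian K)) -mulmxA !det_mulmx mulrCA.
rewrite -det_mulmx.
have uA := spectral_unitarymx (K ^t* *m K).
rewrite -[_ ^t* *m _]mulmx1 -(trmxC_unitary) in uA *.
have := unitarymxP uA; rewrite trmxCK mulmx1 => ->.
by rewrite det1 mulr1 det_diag prodr_ge0 // => i _; apply: gram_spectral_ge0.
Qed.

Lemma det_add1_gram_ge1 m n (K : 'M[C]_(m, n)) : 1 <= \det (1%:M + K ^t* *m K).
Proof.
rewrite det_add1_hermitian ?gram_hermitian //.
apply: (big_ind (fun x => 1 <= x)) => // [x y|i _]; first exact: mulr_ege1.
by rewrite lerDl gram_spectral_ge0.
Qed.

Lemma gram_add m1 m2 n (K : 'M[C]_(m1, n)) (H : 'M[C]_(m2, n)) :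
  K ^t* *m K + H ^t* *m H = (col_mx K H) ^t* *m col_mx K H.
Proof. by rewrite tr_col_mx map_row_mx mul_row_col. Qed.

Lemma gram_unitmx_inj m n p (K : 'M[C]_(m, n)) (V : 'M[C]_(n, p)) :
  K ^t* *m K *m V = 0 -> K *m V = 0.
Proof.
move=> KV0; apply: gram_eq0.
by rewrite trmxC_mul -mulmxA (mulmxA _ K V) KV0 mulmx0.
Qed.

(** Pythagoras for the orthogonal projection of the columns of G onto the
column space of F, whose matrix is F (F* F)^-1 F*. *)
Lemma gram_proj m n p (F : 'M[C]_(m, n)) (G : 'M[C]_(m, p)) :
  F ^t* *m F \in unitmx ->
  G ^t* *m F *m invmx (F ^t* *m F) *m F ^t* *m G
  + (G - F *m invmx (F ^t* *m F) *m F ^t* *m G) ^t*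
    *m (G - F *m invmx (F ^t* *m F) *m F ^t* *m G) = G ^t* *m G.
Proof.
set S := invmx _ => uF.
have SS : S ^t* = S by rewrite trmxC_invmx gram_hermitian.
have trN q r (A : 'M[C]_(q, r)) : (- A) ^t* = - A ^t*.
  by apply/matrixP=> i j; rewrite !mxE rmorphN.
rewrite trmxC_add trN mulmxDl !mulmxDr mulNmx !mulmxN mulNmx.
rewrite !trmxC_mul trmxCK SS !mulmxA.
have -> : G ^t* *m F *m S *m F ^t* *m F *m S = G ^t* *m F *m S.
  have FS : F ^t* *m F *m S = 1%:M by rewrite mulmxV.
  by rewrite -(mulmxA _ (F ^t*) F) -(mulmxA _ _ S) FS mulmx1.
by rewrite opprK addNr addr0 addrC subrK.
Qed.

(** Monotonicity of the determinant on positive semidefinite matrices, with the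
increment given as a Gram matrix.  When M = K* K is invertible, Sylvester's
identity turns det (M + H* H) / det M into det (1 + L* L) with
L = K M^-1 H*, which is at least 1. *)
Lemma det_gramD m1 m2 n (K : 'M[C]_(m1, n)) (H : 'M[C]_(m2, n)) :
  \det (K ^t* *m K) <= \det (K ^t* *m K + H ^t* *m H).
Proof.
have [u|] := boolP (K ^t* *m K \in unitmx); last first.
  rewrite unitmxE unitfE negbK => /eqP ->.
  by rewrite gram_add det_gram_ge0.
set M := K ^t* *m K in u *.
have -> : M + H ^t* *m H = M *m (1%:M + invmx M *m H ^t* *m H).
  by rewrite mulmxDr mulmx1 !mulmxA mulmxV // mul1mx.
rewrite det_mulmx det_add1_mulmxC.
have -> : H *m (invmx M *m H ^t*) =
    (K *m invmx M *m H ^t*) ^t* *m (K *m invmx M *m H ^t*).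
  rewrite !trmxC_mul trmxCK trmxC_invmx gram_hermitian -/M !mulmxA.
  by rewrite -(mulmxA (H *m invmx M)) -/M mulmxKV.
by rewrite -[leLHS]mulr1 ler_wpM2l ?det_gram_ge0 ?det_add1_gram_ge1.
Qed.

(** Projecting G onto the column space of F only decreases det (G* G), and the
projected Gram determinant is |det (F* G)|^2 / det (F* F). *)
Lemma det_gram_CauchySchwarz m n (F G : 'M[C]_(m, n)) :
  `|\det (F ^t* *m G)| ^+ 2 <= \det (F ^t* *m F) * \det (G ^t* *m G).
Proof.
(* If det (F* F) = 0, a row vector kills F*, hence also F* G. *)
have [u|] := boolP (F ^t* *m F \in unitmx); last first.
  rewrite unitmxE unitfE negbK => F0; rewrite (eqP F0) mul0r.
  have /det0P[v v0 vF] := F0.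
  suff -> : \det (F ^t* *m G) = 0 by rewrite normr0 expr0n.
  apply/eqP/det0P; exists v => //; rewrite mulmxA.
  suff -> : v *m F ^t* = 0 by rewrite mul0mx.
  rewrite -[LHS]trmxCK trmxC_mul trmxCK.
  rewrite gram_unitmx_inj ?trmx0 ?map_mx0 //.
  by rewrite -[LHS]trmxCK trmxC_mul gram_hermitian trmxCK vF trmx0 map_mx0.
set M := F ^t* *m F in u *.
set H := G - F *m invmx M *m F ^t* *m G.
have := det_gramD (F *m invmx M *m F ^t* *m G) H.
have -> : (F *m invmx M *m F ^t* *m G) ^t* *m (F *m invmx M *m F ^t* *m G)
    = G ^t* *m F *m invmx M *m F ^t* *m G.
  rewrite !trmxC_mul trmxCK trmxC_invmx gram_hermitian -/M !mulmxA.
  by rewrite -(mulmxA _ (F ^t*) F) -/M mulmxKV.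
rewrite gram_proj // => le.
have -> : `|\det (F ^t* *m G)| ^+ 2 =
    \det M * \det (G ^t* *m F *m invmx M *m F ^t* *m G).
  have -> : G ^t* *m F = (F ^t* *m G) ^t* by rewrite trmxC_mul trmxCK.
  rewrite -(mulmxA _ (F ^t*)) !det_mulmx -[in RHS](det_tr (F ^t* *m G)).
  rewrite det_map_mx det_inv normCK det_tr mulrA mulrCA mulrAC.
  by rewrite divff ?mulr1 1?mulrC // -unitfE -unitmxE.
by rewrite ler_wpM2l ?det_gram_ge0.
Qed.

(** After division by det (W* W), Sylvester's identity moves W to the other
side: the determinant of 1 + G Pi G* is to be compared with that of 1 + G G*,
where Pi is the orthogonal projection onto the column space of W. *)
Lemma det_compression m n k (G : 'M[C]_(m, n)) (W : 'M[C]_(n, k)) :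
  \det (W ^t* *m (1%:M + G ^t* *m G) *m W)
  <= \det (W ^t* *m W) * \det (1%:M + G ^t* *m G).
Proof.
rewrite mulmxDr mulmx1 mulmxDl.
have -> : W ^t* *m (G ^t* *m G) *m W = W ^t* *m G ^t* *m (G *m W).
  by rewrite !mulmxA.
set M := W ^t* *m W.
have [u|] := boolP (M \in unitmx); last first.
  rewrite unitmxE unitfE negbK => W0; rewrite (eqP W0) mul0r.
  have /det0P[v v0 vW] := W0.
  suff -> : \det (M + W ^t* *m G ^t* *m (G *m W)) = 0 by [].
  apply/eqP/det0P; exists v => //; rewrite mulmxDr vW add0r !mulmxA.
  suff -> : v *m W ^t* = 0 by rewrite !mul0mx.
  rewrite -[LHS]trmxCK trmxC_mul trmxCK.
  rewrite gram_unitmx_inj ?trmx0 ?map_mx0 //.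
  by rewrite -[LHS]trmxCK trmxC_mul gram_hermitian trmxCK vW trmx0 map_mx0.
have -> : M + W ^t* *m G ^t* *m (G *m W) =
    M *m (1%:M + invmx M *m W ^t* *m G ^t* *m (G *m W)).
  by rewrite mulmxDr mulmx1 !mulmxA mulmxV // mul1mx.
rewrite det_mulmx ler_wpM2l ?det_gram_ge0 //.
rewrite det_add1_mulmxC [leRHS]det_add1_mulmxC.
have := gram_proj (G ^t*) u; rewrite trmxCK.
set H := _ - _ => <-.
set N := W *m invmx M *m W ^t* *m G ^t*.
have -> : G *m W *m (invmx M *m W ^t* *m G ^t*) = N ^t* *m N.
  rewrite /N !trmxC_mul !trmxCK trmxC_invmx gram_hermitian -/M !mulmxA.
  by rewrite -(mulmxA _ (W ^t*) W) -/M mulmxKV.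
have -> : G *m W *m invmx M *m W ^t* *m G ^t* = N ^t* *m N.
  rewrite /N !trmxC_mul !trmxCK trmxC_invmx gram_hermitian -/M !mulmxA.
  by rewrite -(mulmxA _ (W ^t*) W) -/M mulmxKV.
rewrite addrA -{1 2}[1%:M]mulmx1 -[X in X *m 1%:M]trmxC1 gram_add.
exact: det_gramD.
Qed.

Lemma diag_gram n (c : 'rV[C]_n) : (forall i, 0 <= c 0 i) ->
  diag_mx c = (diag_mx (map_mx sqrtC c)) ^t* *m diag_mx (map_mx sqrtC c).
Proof.
move=> c0; rewrite trmxC_diag mulmx_diag; congr diag_mx.
apply/rowP=> i; rewrite !mxE [X in X * _]conj_Creal ?sqrtC_real //.
by rewrite -expr2 sqrtCK.
Qed.

(** With al the k-th largest entry, raising the smaller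
entries of the diagonal to al can only increase the determinant, and divided
by al the diagonal becomes 1 plus a Gram matrix; [det_compression] then leaves
exactly the first k entries.  When al = 0 both sides vanish. *)
Lemma det_diag_compression n k (a : 'I_n -> C) (W : 'M[C]_(n, k)) :
  (k <= n)%N -> (forall i, 0 <= a i) ->
  (forall i j : 'I_n, (i <= j)%N -> a j <= a i) ->
  \det (W ^t* *m diag_mx (\row_i a i) *m W)
  <= \det (W ^t* *m W) * \prod_(i < n | (i < k)%N) a i.
Proof.
case: k W => [|k] W kn a0 ad.
  by rewrite !det_mx00 big1 ?mulr1.
pose m := Ordinal kn.
have := a0 m; rewrite le0r => /predU1P[am0|am_gt0].
  rewrite (bigD1 m) //= am0 mul0r mulr0.
  suff /eqP -> : \det (W ^t* *m diag_mx (\row_i a i) *m W) == 0 by [].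
  rewrite -[_ == _]negbK -unitfE -unitmxE -row_full_unit /row_full.
  have -> : diag_mx (\row_i a i) = (pid_mx k : 'M[C]_n) *m diag_mx (\row_i a i).
    apply/matrixP=> i j; rewrite mul_mx_diag !mxE.
    rewrite -[(i == j :> nat)]/(i == j).
    case: eqP => [<-|_]; last by rewrite mul0r mulr0n.
    rewrite /=; case: ltnP => [_|le]; first by rewrite mul1r mulr1n.
    rewrite mul0r mulr1n; apply/eqP; rewrite eq_le a0 andbT -am0.
    exact: ad.
  rewrite neq_ltn; apply/orP; left; rewrite ltnS.
  apply: (leq_trans (mxrankM_maxl _ _)).
  apply: (leq_trans (mxrankM_maxr _ _)).
  apply: (leq_trans (mxrankM_maxl _ _)).
  by rewrite rank_pid_mx // ltnW.
set al := a m in am_gt0.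
pose b (i : 'I_n) := if (i < k.+1)%N then a i else al.
have ab i : a i <= b i.
  by rewrite /b; case: ltnP => // le; apply: ad; apply: ltnW.
have alb i : al <= b i.
  by rewrite /b; case: ltnP => // le; apply: ad.
pose c := \row_(i < n) (b i / al - 1).
have c0 i : 0 <= c 0 i by rewrite mxE subr_ge0 ler_pdivlMr // mul1r.
have e0 i : 0 <= (\row_i (b i - a i)) 0 i by rewrite mxE subr_ge0.
have ga i : 0 <= (\row_i a i) 0 i by rewrite mxE.
apply: (@le_trans _ _ (\det (W ^t* *m diag_mx (\row_i b i) *m W))).
  have -> : diag_mx (\row_i b i) =
    diag_mx (\row_i a i) + diag_mx (\row_i (b i - a i)).
    rewrite -linearD; congr diag_mx; apply/rowP=> i.
    by rewrite !mxE addrC subrK.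
  rewrite mulmxDr mulmxDl (diag_gram ga) (diag_gram e0) !mulmxA -!trmxC_mul.
  by rewrite -!(mulmxA _ _ W) det_gramD.
have -> : diag_mx (\row_i b i) = al *: (1%:M + diag_mx c).
  rewrite -diag_const_mx -linearD /= -linearZ; congr diag_mx.
  apply/rowP=> i; rewrite !mxE addrC subrK mulrC divfK //.
  by rewrite gt_eqF.
rewrite -scalemxAr -scalemxAl detZ.
apply: (@le_trans _ _ (al ^+ k.+1 *
   (\det (W ^t* *m W) * \det (1%:M + diag_mx c)))).
  rewrite ler_wpM2l ?exprn_ge0 ?(ltW am_gt0) //.
  by have := det_compression (diag_mx (map_mx sqrtC c)) W; rewrite -diag_gram.
rewrite mulrCA ler_wpM2l ?det_gram_ge0 //.
rewrite -diag_const_mx -linearD /= det_diag.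
rewrite (bigID (fun i : 'I_n => (i < k.+1)%N)) /= [X in _ * (_ * X)]big1 ?mulr1.
  rewrite le_eqVlt; apply/orP; left; apply/eqP.
  have -> : al ^+ k.+1 = \prod_(i < n | (i < k.+1)%N) al.
    by rewrite -(big_ord_widen n (fun=> al)) // prodr_const card_ord.
  rewrite -big_split /=; apply: eq_bigr => i ik; rewrite !mxE /b ik.
  by rewrite addrC subrK mulrC divfK // gt_eqF.
move=> i; rewrite -leqNgt => ik; rewrite !mxE /b ltnNge ik /=.
by rewrite addrC subrK divff // gt_eqF.
Qed.

Lemma det_gram_compression n k (T U : 'M[C]_n) (c : 'I_n -> C)
    (W : 'M[C]_(n, k)) :
  U \is unitarymx -> T ^t* *m T = U ^t* *m diag_mx (\row_i c i) *m U ->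
  (k <= n)%N -> (forall i, 0 <= c i) ->
  (forall i j : 'I_n, (i <= j)%N -> c j <= c i) ->
  \det ((T *m W) ^t* *m (T *m W))
  <= \det (W ^t* *m W) * \prod_(i < n | (i < k)%N) c i.
Proof.
move=> uU TE kn c0 cd; have := det_diag_compression (U *m W) kn c0 cd.
have -> : (U *m W) ^t* *m diag_mx (\row_i c i) *m (U *m W) =
    (T *m W) ^t* *m (T *m W).
  by rewrite !trmxC_mul !mulmxA -(mulmxA (W ^t*) (T ^t*)) TE -!mulmxA.
suff -> : (U *m W) ^t* *m (U *m W) = W ^t* *m W by [].
rewrite trmxC_mul mulmxA -(mulmxA (W ^t*)).
move: uU; rewrite -trmxC_unitary => /unitarymxP; rewrite trmxCK => ->.
by rewrite mulmx1.
Qed.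

(** The hypothesis makes P* Q similar to Y* Y through D.  If the columns of V
are the first k eigenvectors of Y* Y and W = D V, then
W* P* Q W = W* W L with L the diagonal of the k largest eigenvalues, so
det L is controlled by the Cauchy-Schwarz inequality for (P W, Q W). *)
Lemma singular_value_product n (Y P Q D : 'M[C]_n) (UY UP UQ : 'M[C]_n)
    (l a b : 'I_n -> C) k :
  D \in unitmx -> P ^t* *m Q *m D = D *m (Y ^t* *m Y) ->
  UY \is unitarymx -> UP \is unitarymx -> UQ \is unitarymx ->
  Y ^t* *m Y = UY ^t* *m diag_mx (\row_i l i) *m UY ->
  P ^t* *m P = UP ^t* *m diag_mx (\row_i a i) *m UP ->
  Q ^t* *m Q = UQ ^t* *m diag_mx (\row_i b i) *m UQ ->
  (forall i, 0 <= l i) -> (forall i, 0 <= a i) -> (forall i, 0 <= b i) ->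
  (forall i j : 'I_n, (i <= j)%N -> a j <= a i) ->
  (forall i j : 'I_n, (i <= j)%N -> b j <= b i) ->
  (k <= n)%N ->
  (\prod_(i < n | (i < k)%N) l i) ^+ 2
  <= \prod_(i < n | (i < k)%N) a i * \prod_(i < n | (i < k)%N) b i.
Proof.
move=> uD PQD uUY uUP uUQ YE PE QE l0 a0 b0 ad bd kn.
have UYV : UY *m UY ^t* = 1%:M by apply/unitarymxP.
pose V := colsub (widen_ord kn) (UY ^t*).
pose L := diag_mx (\row_(i < k) l (widen_ord kn i)).
have YV : Y ^t* *m Y *m V = V *m L.
  rewrite YE /V mulmx_colsub -!mulmxA UYV mulmx1.
  by apply/matrixP=> i j; rewrite !mul_mx_diag !mxE.
have VV : V ^t* *m V = 1%:M.
  apply/matrixP=> i j.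
  have /matrixP/(_ (widen_ord kn i) (widen_ord kn j)) := UYV.
  rewrite !mxE -[widen_ord kn i == widen_ord kn j]/(i == j) => <-.
  by apply: eq_bigr => p _; rewrite !mxE conjCK.
pose W := D *m V.
have WL : P ^t* *m Q *m W = W *m L.
  by rewrite /W mulmxA PQD -!mulmxA -YV !mulmxA.
have detW : 0 < \det (W ^t* *m W).
  rewrite lt_def det_gram_ge0 andbT; apply/negP => /det0P[v v0].
  move=> vW; have : W *m v ^t* = 0.
    apply: gram_unitmx_inj.
    by rewrite -[LHS]trmxCK trmxC_mul gram_hermitian trmxCK vW trmx0 map_mx0.
  rewrite /W -mulmxA => /(congr1 (mulmx (invmx D))).
  rewrite mulKmx // mulmx0 => /(congr1 (mulmx (V ^t*))).
  rewrite mulmxA VV mul1mx mulmx0 => /(congr1 (fun M : 'M[C]_(k, 1) => M ^t*)).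
  by rewrite trmxCK trmx0 map_mx0 => /eqP; rewrite (negPf v0).
have detL : \det L = \prod_(i < n | (i < k)%N) l i.
  rewrite det_diag (big_ord_narrow kn).
  by apply: eq_bigr => i _; rewrite mxE.
have E : \det ((P *m W) ^t* *m (Q *m W)) = \det (W ^t* *m W) * \det L.
  by rewrite trmxC_mul -mulmxA (mulmxA _ Q) WL mulmxA det_mulmx.
have := det_gram_CauchySchwarz (P *m W) (Q *m W).
have leP := det_gram_compression W uUP PE kn a0 ad.
have leQ := det_gram_compression W uUQ QE kn b0 bd.
rewrite E detL normrM exprMn ger0_norm ?det_gram_ge0 // ger0_norm ?prodr_ge0 //.
move=> /le_trans/(_ (ler_pM (det_gram_ge0 _) (det_gram_ge0 _) leP leQ)).
by rewrite [leRHS]mulrACA -expr2 ler_pM2l ?exprn_gt0.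
Qed.

End Gram.

(** * Symmetric gauges and weak log-majorization *)

Section SymmetricGauge.
Variables (R : realType) (d : nat) (nrm : 'M[R[i]]_d -> R).
Hypothesis nrmP : unitarily_invariant_norm nrm.

Definition dgm (x : 'I_d -> R) : 'M[R[i]]_d := diag_mx (\row_i (x i)%:C).

(** For a unitarily invariant norm this is a symmetric gauge function: a norm on
R^d invariant under permutations and sign changes of the coordinates. *)
Definition gauge (x : 'I_d -> R) : R := nrm (dgm x).

Lemma dgmE x i j : dgm x i j = (x j)%:C *+ (i == j).
Proof. by rewrite !mxE; case: eqP => [->|]. Qed.

Lemma dgmM x y : dgm x *m dgm y = dgm (fun i => x i * y i).
Proof.
by rewrite mulmx_diag; congr diag_mx; apply/rowP=> i; rewrite !mxE rmorphM.
Qed.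

Lemma dgm_trmxC x : ((dgm x) ^t* )%sesqui = dgm x.
Proof.
rewrite trmxC_diag; congr diag_mx; apply/rowP=> i.
by rewrite !mxE conj_Creal ?complex_real.
Qed.

Lemma dgm1 : dgm (fun=> 1) = 1%:M.
Proof. by apply/matrixP=> i j; rewrite dgmE !mxE. Qed.

Lemma perm_mx_unitary (s : 'S_d) : (perm_mx s : 'M[R[i]]_d) \is unitarymx.
Proof.
apply/unitarymxP; rewrite tr_perm_mx map_perm_mx -perm_mxM mulgV.
exact: perm_mx1.
Qed.

Lemma dgm_perm x (s : 'S_d) :
  dgm (x \o s) = perm_mx s *m dgm x *m perm_mx s^-1.
Proof.
rewrite -row_permE -col_permE; apply/matrixP=> i j.
by rewrite !mxE /= (inj_eq perm_inj).
Qed.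

Lemma gauge_ge0 x : 0 <= gauge x.
Proof. exact: uinorm_ge0. Qed.

Lemma gauge_ext x y : x =1 y -> gauge x = gauge y.
Proof. by move=> /funext ->. Qed.

Lemma gaugeZ a x : 0 <= a -> gauge (fun i => a * x i) = a * gauge x.
Proof.
move=> a0; apply: complexI; rewrite rmorphM /=.
have -> : (a%:C : R[i]) = `|a%:C| by rewrite ger0_norm // ler0c.
rewrite -(uinormZ nrmP); congr (nrm _)%:C.
by apply/matrixP=> i j; rewrite !mxE rmorphM mulrnAr.
Qed.

Lemma gaugeD x y : gauge (fun i => x i + y i) <= gauge x + gauge y.
Proof.
apply: le_trans (uinormD nrmP _ _); rewrite le_eqVlt; apply/orP; left.
apply/eqP; congr nrm; apply/matrixP=> i j.
by rewrite !mxE rmorphD mulrnDl.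
Qed.

Lemma gauge_convex l x y : 0 <= l <= 1 ->
  gauge (fun i => l * x i + (1 - l) * y i) <= l * gauge x + (1 - l) * gauge y.
Proof.
move=> /andP[l0 l1]; apply: le_trans (gaugeD _ _) _.
by rewrite !gaugeZ // subr_ge0.
Qed.

Lemma gauge_perm x (s : 'S_d) : gauge (x \o s) = gauge x.
Proof. by rewrite /gauge dgm_perm uinormU // perm_mx_unitary. Qed.

Lemma gauge_flip x i :
  gauge (fun k => if k == i then - x k else x k) = gauge x.
Proof.
pose e (k : 'I_d) : R := if k == i then -1 else 1.
have ue : dgm e \is unitarymx.
  apply/unitarymxP; rewrite dgm_trmxC dgmM -dgm1; congr dgm; apply/funext=> k.
  by rewrite /e; case: eqP; rewrite ?mulrNN mulr1.
have u1 : (1%:M : 'M[R[i]]_d) \is unitarymx.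
  by apply/unitarymxP; rewrite trmxC1 mulmx1.
rewrite -[RHS](uinormU nrmP _ ue u1) mulmx1 dgmM; apply: gauge_ext => k.
by rewrite /e; case: eqP; rewrite ?mulN1r ?mul1r.
Qed.

Definition upd (x : 'I_d -> R) i y k := if k == i then y else x k.

(** A coordinate of smaller modulus makes the vector a convex combination of x
and of x with that coordinate negated. *)
Lemma gauge_upd_le x i y : `|y| <= x i -> gauge (upd x i y) <= gauge x.
Proof.
rewrite ler_norml => /andP[y1 y2].
have [x0|x0] := eqVneq (x i) 0.
  rewrite (_ : upd x i y = x) //; apply/funext=> k; rewrite /upd.
  by case: eqP => // ->; lra.
pose l := (y + x i) / (2 * x i).
have xp : 0 < 2 * x i by move/eqP in x0; lra.
have l01 : 0 <= l <= 1.
  by rewrite /l divr_ge0 ?ler_pdivrMr //; lra.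
rewrite -[leRHS]mul1r -[X in X * _](subrK l) mulrDl addrC.
rewrite -{2}(gauge_flip x i).
apply: le_trans (gauge_convex _ _ l01).
rewrite le_eqVlt; apply/orP; left; apply/eqP; apply: gauge_ext => k.
rewrite /upd; case: eqP => [->|_]; last by lra.
by rewrite /l; field.
Qed.

(** The coordinates are lowered one at a time; z m is the vector after the
first m steps. *)
Lemma gauge_le x y : (forall i, 0 <= x i <= y i) -> gauge x <= gauge y.
Proof.
move=> xy; pose z m (k : 'I_d) := if (k < m)%N then x k else y k.
have zm m : gauge (z m) <= gauge y.
  elim: m => [|m IH]; first by rewrite (gauge_ext (y := y)).
  have [md|dm] := ltnP m d; last first.
    rewrite (gauge_ext (y := z m)) // => k; rewrite /z.
    have km := leq_trans (ltn_ord k) dm.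
    by rewrite km (leq_trans km (leqnSn m)).
  apply: le_trans IH; pose i := Ordinal md.
  have := @gauge_upd_le (z m) i (x i).
  rewrite (gauge_ext (x := upd _ _ _) (y := z m.+1)); first apply.
    rewrite /z /= ltnn; have /andP[x0 x1] := xy i.
    by rewrite ger0_norm.
  move=> k; rewrite /upd /z; case: (k =P i) => [->|ki] /=.
    by rewrite ltnSn.
  rewrite ltnS [(k <= m)%N]leq_eqVlt.
  suff -> : (k == m :> nat) = false by [].
  by apply/eqP => km; apply: ki; apply/val_inj.
rewrite -(gauge_ext (x := z d)) // => k.
by rewrite /z ltn_ord.
Qed.

(** Bringing two coordinates closer together without increasing their sum: the
result is dominated by a convex combination of c and of c with the two
coordinates exchanged. *)
Lemma gauge_transfer c i j p q : i != j -> (forall k, 0 <= c k) ->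
  c j <= p <= c i -> c j <= q -> p + q <= c i + c j ->
  gauge (upd (upd c i p) j q) <= gauge c.
Proof.
move=> ij c0 /andP[jp pi_] jq pq.
have [pE|cij] := eqVneq (c i) (c j).
  apply: gauge_le => k; rewrite /upd; have := c0 k; have := c0 j.
  case: eqP => [->|_]; first lra.
  by case: eqP => [->|_]; lra.
have cp : 0 < c i - c j by move/eqP in cij; lra.
pose l := (p - c j) / (c i - c j).
have l01 : 0 <= l <= 1 by rewrite /l divr_ge0 ?ler_pdivrMr //; lra.
rewrite -[leRHS]mul1r -[X in X * _](subrK l) mulrDl addrC.
rewrite -{2}(gauge_perm c (tperm i j)).
apply: le_trans (gauge_convex _ _ l01).
have lp : l * c i + (1 - l) * c j = p by rewrite /l; field; rewrite gt_eqF.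
apply: gauge_le => k; rewrite /upd /=; have := c0 k; have := c0 j.
case: (k =P j) => [->|/eqP kj]; first by rewrite tpermR; lra.
case: (k =P i) => [->|/eqP ki]; first by rewrite tpermL; lra.
by rewrite tpermD 1?eq_sym //; lra.
Qed.

(** As long as c does not dominate x entrywise, let j be the first index
with c j < x j; some earlier i has c i > x i, otherwise the prefix
product up to j would be too small.  Multiplying c j and dividing c i by a
common factor, until one of them meets x, keeps the products over prefixes
large enough, does not increase the gauge, and makes one more coordinate of c
agree with x.  Phrased with products, so that zero entries are allowed. *)
Lemma gauge_weak_log_majorization x c :
  (forall i, 0 <= x i) -> (forall i, 0 <= c i) ->
  (forall i j : 'I_d, (i <= j)%N -> x j <= x i) ->
  (forall k, (k <= d)%N ->
     \prod_(l < d | (l < k)%N) x l <= \prod_(l < d | (l < k)%N) c l) ->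
  gauge x <= gauge c.
Proof.
move=> x0 c0 xd; have [m] := ubnP #|[set l | c l != x l]|.
elim: m c c0 => // m IH c c0 cm xc.
have [/forallP xlec|] := boolP [forall l, x l <= c l].
  by apply: gauge_le => l; rewrite x0 xlec.
rewrite negb_forall => /existsP[j0]; rewrite -ltNge => cj0.
pose deficient (j : 'I_d) := c j < x j.
have [j cj jmin] := @arg_minnP _ _ deficient (fun j => j : nat) cj0.
have xc_before (l : 'I_d) : (l < j)%N -> x l <= c l.
  move=> lj; rewrite leNgt; apply/negP => /jmin.
  by rewrite leqNgt lj.
have xj0 : 0 < x j := le_lt_trans (c0 j) cj.
have [i ij ci] : exists2 i : 'I_d, (i < j)%N & x i < c i.
  apply: contrapT => noi.
  have eqb (l : 'I_d) : (l < j)%N -> c l = x l.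
    move=> lj; apply/eqP; rewrite eq_le xc_before // andbT leNgt.
    by apply/negP => xl; apply: noi; exists l.
  have := xc j.+1 (ltn_ord j).
  rewrite (bigD1 j) //= [leRHS](bigD1 j) //=.
  have -> : \prod_(l < d | (l < j.+1)%N && (l != j)) c l =
            \prod_(l < d | (l < j.+1)%N && (l != j)) x l.
    apply: eq_bigr => l /andP[lj lNj]; apply: eqb.
    by rewrite ltn_neqAle lNj -ltnS.
  rewrite leNgt => /negP; apply; rewrite ltr_pM2r // prodr_gt0 //.
  by move=> l /andP[lj _]; apply: lt_le_trans xj0 (xd _ _ _).
have iNj : i != j by apply: contraTneq ij => ->; rewrite ltnn.
have xi0 : 0 < x i by apply: lt_le_trans xj0 (xd _ _ (ltnW ij)).
have ci0 : 0 < c i := lt_trans xi0 ci.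
have xji : x j <= x i := xd _ _ (ltnW ij).
(* p and q are the new values at i and j: the transfer stops at whichever of
   p = x i and q = x j is reached first. *)
have [p [q [pq pi_ qj pqx]]] : exists p q, [/\ p * q = c i * c j,
    x i <= p <= c i, c j <= q <= x j & (p == x i) || (q == x j)].
  have [le|gt] := leP (c i * c j / x i) (x j).
    exists (x i), (c i * c j / x i); rewrite eqxx lexx (ltW ci) le andbT.
    split=> //; first by rewrite mulrC divfK ?gt_eqF.
    by rewrite ler_pdivlMr // mulrC ler_wpM2r // ltW.
  exists (c i * c j / x j), (x j); rewrite eqxx lexx (ltW cj) orbT andbT.
  split=> //; first by rewrite divfK ?gt_eqF.
  apply/andP; split.
    by move: gt; rewrite ltr_pdivlMr // ler_pdivlMr // mulrC => /ltW.
  by rewrite ler_pdivrMr // ler_wpM2l // ltW.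
pose c' := upd (upd c i p) j q.
have c'i : c' i = p by rewrite /c' /upd (negPf iNj) eqxx.
have c'j : c' j = q by rewrite /c' /upd eqxx.
have c'k k : k != i -> k != j -> c' k = c k.
  by move=> /negPf ki /negPf kj; rewrite /c' /upd ki kj.
have [/andP[xip pci] /andP[cjq qxj]] := (pi_, qj).
apply: (@le_trans _ _ (gauge c')); last first.
  apply: gauge_transfer => //; first lra.
  rewrite -(ler_pM2l ci0) -subr_ge0.
  have -> : c i * (c i + c j) - c i * (p + q) = (c i - p) * (c i - q).
    by rewrite !mulrDr -pq; ring.
  by rewrite mulr_ge0 //; lra.
apply: IH.
- move=> k; rewrite /c' /upd; case: eqP => [_|_]; first exact: le_trans cjq.
  by case: eqP => [_|_] //; lra.
- (* fewer coordinates of c' than of c differ from x *)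
  rewrite -ltnS; apply: leq_trans cm; rewrite ltnS; apply: proper_card.
  apply/properP; split.
    apply/fintype.subsetP => k; rewrite !inE.
    have [->|ki] := eqVneq k i; first by rewrite (gt_eqF ci).
    have [->|kj] := eqVneq k j; first by rewrite (lt_eqF (cj : c j < x j)).
    by rewrite c'k.
  case/orP: pqx => /eqP E.
    by exists i; rewrite inE ?c'i ?E ?eqxx // (gt_eqF ci).
  by exists j; rewrite inE ?c'j ?E ?eqxx // (lt_eqF (cj : c j < x j)).
- (* up to j, c' dominates x entrywise; beyond j, both i and j occur and the
     product is that of c *)
  move=> k kd; have [kj|jk] := leqP k j.
    apply: ler_prod => l lk; rewrite x0 /=.
    have [->|li] := eqVneq l i; first by rewrite c'i.
    have lj := leq_trans lk kj.
    have lNj : l != j by apply: contraTneq lj => ->; rewrite ltnn.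
    by rewrite c'k // xc_before.
  have ik := ltn_trans ij jk.
  have jNi : j != i by rewrite eq_sym.
  apply: le_trans (xc k kd) _; rewrite le_eqVlt; apply/orP; left; apply/eqP.
  rewrite (bigD1 i) //= (bigD1 j) /= ?jk //.
  rewrite [RHS](bigD1 i) //= [X in _ = _ * X](bigD1 j) /= ?jk //.
  rewrite c'i c'j !mulrA pq; congr (_ * _); apply: eq_bigr => l.
  by move=> /andP[/andP[_ li] lj]; rewrite c'k.
Qed.

(** The arithmetic-geometric mean gives 2 z <= s a + b / s for every s > 0; the
value of s that equalizes the gauges of the two terms is optimal. *)
Lemma gauge_CauchySchwarz z a b :
  (forall i, 0 <= z i) -> (forall i, 0 <= a i) -> (forall i, 0 <= b i) ->
  (forall i, z i ^+ 2 = a i * b i) -> gauge z ^+ 2 <= gauge a * gauge b.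
Proof.
move=> z0 a0 b0 zab.
have gz0 y : (forall i, 0 <= y i) -> gauge y = 0 -> forall i, y i = 0.
  move=> y0 /(uinorm_eq0 nrmP) /matrixP yE i; have := yE i i.
  by rewrite dgmE eqxx mxE => /complexI.
have z00 y : (forall i, y i = 0) -> gauge y = 0.
  move=> yE; rewrite (gauge_ext (y := fun i => 0 * y i)) ?gaugeZ ?mul0r // => i.
  by rewrite mul0r.
have zz : (forall i, z i ^+ 2 = 0) -> gauge z ^+ 2 <= gauge a * gauge b.
  move=> zE; rewrite z00 ?expr0n ?mulr_ge0 ?gauge_ge0 // => i.
  by apply/eqP; rewrite -sqrf_eq0 zE.
have [ga0|ga0] := eqVneq (gauge a) 0.
  by apply: zz => i; rewrite zab (gz0 _ a0 ga0) mul0r.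
have [gb0|gb0] := eqVneq (gauge b) 0.
  by apply: zz => i; rewrite zab (gz0 _ b0 gb0) mulr0.
have gap : 0 < gauge a by rewrite lt0r ga0 gauge_ge0.
have gbp : 0 < gauge b by rewrite lt0r gb0 gauge_ge0.
pose s := Num.sqrt (gauge b / gauge a).
have sp : 0 < s by rewrite sqrtr_gt0 divr_gt0.
have sE : s ^+ 2 = gauge b / gauge a by rewrite sqr_sqrtr // divr_ge0 // ltW.
have le : gauge (fun i => 2 * z i) <= s * gauge a + s^-1 * gauge b.
  have sVp : 0 < s^-1 by rewrite invr_gt0.
  rewrite -(gaugeZ a (ltW sp)) -(gaugeZ b (ltW sVp)).
  apply: le_trans (gaugeD _ _).
  apply: gauge_le => i; rewrite mulr_ge0 //=.
  have sa0 : 0 <= s * a i by rewrite mulr_ge0 // ltW.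
  have sb0 : 0 <= s^-1 * b i by rewrite mulr_ge0 // ltW.
  have ab : z i ^+ 2 = s * a i * (s^-1 * b i).
    by rewrite zab mulrACA divff ?mul1r // gt_eqF.
  have lhs0 : 0 <= 2 * z i by rewrite mulr_ge0.
  rewrite -ler_sqr ?nnegrE //; last exact: addr_ge0.
  rewrite exprMn ab.
  by have := sqr_ge0 (s * a i - s^-1 * b i); nra.
rewrite gaugeZ // in le.
have bE : gauge b = s ^+ 2 * gauge a by rewrite sE divfK.
have : gauge z <= s * gauge a.
  rewrite bE in le; move: le; rewrite expr2 !mulrA mulVf ?gt_eqF // mul1r; lra.
have -> : gauge a * gauge b = (s * gauge a) ^+ 2 by rewrite bE; ring.
by rewrite ler_sqr ?nnegrE ?gauge_ge0 ?mulr_ge0 ?gauge_ge0 ?(ltW sp).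
Qed.

End SymmetricGauge.

(** * Spectral functional calculus *)

Section FunctionalCalculus.
Variables (R : realType) (d : nat).
Local Open Scope sesquilinear_scope.
Implicit Types (U P : 'M[R[i]]_d) (a : 'I_d -> R).

Lemma unitarymx_VK U : U \is unitarymx -> U ^t* *m U = 1%:M.
Proof. by rewrite -trmxC_unitary => /unitarymxP; rewrite trmxCK. Qed.

Lemma dgm_conj_hermitian U a : (U ^t* *m dgm a *m U) ^t* = U ^t* *m dgm a *m U.
Proof. by rewrite !trmxC_mul trmxCK dgm_trmxC mulmxA. Qed.

Lemma dgm_conjM U a b : U \is unitarymx ->
  U ^t* *m dgm a *m U *m (U ^t* *m dgm b *m U) =
  U ^t* *m dgm (fun i => a i * b i) *m U.
Proof.
move=> /unitarymxP uU; rewrite -dgmM -!mulmxA; congr (_ *m (_ *m _)).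
by rewrite !mulmxA uU mul1mx.
Qed.

Lemma spectral_decomp_dgm (A : 'M[R[i]]_d) : A ^t* = A ->
  A = (spectralmx A) ^t*
    *m dgm (fun i => complex.Re (spectral_diag A 0 i)) *m spectralmx A.
Proof.
move=> hA; rewrite {1}(spectral_decomp hA).
suff -> : diag_mx (spectral_diag A) =
    dgm (fun i => complex.Re (spectral_diag A 0 i)) by [].
congr diag_mx; apply/rowP=> i; rewrite mxE.
have /hermsymmxP/hermitian_spectral_diag_real/mxOverP := hA.
by move=> /(_ 0 i) /RRe_real ->.
Qed.

Lemma conj_dgm_ext U a b : a =1 b ->
  U ^t* *m dgm a *m U = U ^t* *m dgm b *m U.
Proof. by move=> /funext ->. Qed.

(** Two unitary diagonalizations of one matrix give the same functional
calculus: W = P U* intertwines the two diagonals, so W i j = 0 unless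
l i = a j, and W then also intertwines their images under g. *)
Lemma conj_dgm_transport (g : R -> R) P U l a :
  P \is unitarymx -> U \is unitarymx ->
  P ^t* *m dgm l *m P = U ^t* *m dgm a *m U ->
  P ^t* *m dgm (g \o l) *m P = U ^t* *m dgm (g \o a) *m U.
Proof.
move=> uP uU PU; move WE : (P *m U ^t*) => W.
have EP : dgm l *m W = W *m dgm a.
  have := congr1 (fun M => P *m M *m U ^t*) PU.
  rewrite !mulmxA (unitarymxP uP) mul1mx WE -(mulmxA _ U) (unitarymxP uU).
  by rewrite mulmx1 -mulmxA WE.
have PUW : P = W *m U by rewrite -WE -mulmxA unitarymx_VK // mulmx1.
have UPW : P ^t* *m W = U ^t* by rewrite -WE mulmxA unitarymx_VK // mul1mx.
have EW : dgm (g \o l) *m W = W *m dgm (g \o a).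
  apply/matrixP=> i j; have /matrixP/(_ i j) := EP.
  rewrite !mul_diag_mx !mul_mx_diag !mxE /= mulrC.
  have [->|W0] := eqVneq (W i j) 0; first by rewrite !mul0r mulr0.
  by move=> /(mulfI W0) /complexI ->; rewrite mulrC.
rewrite [X in _ *m X]PUW mulmxA -(mulmxA (P ^t*)) EW.
by rewrite mulmxA UPW.
Qed.

Lemma mxfunE (g : R -> R) (A : 'M[R[i]]_d) :
  mxfun g A = (spectralmx A) ^t*
    *m dgm (fun i => g (complex.Re (spectral_diag A 0 i))) *m spectralmx A.
Proof. by rewrite /mxfun invmx_unitary ?spectral_unitarymx. Qed.

Lemma mxfun_conj_dgm (g : R -> R) U a : U \is unitarymx ->
  mxfun g (U ^t* *m dgm a *m U) = U ^t* *m dgm (g \o a) *m U.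
Proof.
move=> uU; have := spectral_decomp_dgm (dgm_conj_hermitian U a).
rewrite mxfunE; have := spectral_unitarymx (U ^t* *m dgm a *m U).
move: (spectralmx _) (spectral_diag _) => P lam uP AE.
exact: (conj_dgm_transport g uP uU (esym AE)).
Qed.

(** The spectral theorem does not order the eigenvalues; a permutation matrix
absorbed in the unitary factor sorts them. *)
Lemma sorted_gram_decomp (K : 'M[R[i]]_d) : exists U a,
  [/\ U \is unitarymx, (forall i, 0 <= a i),
    (forall i j : 'I_d, (i <= j)%N -> a j <= a i) &
    K ^t* *m K = U ^t* *m dgm a *m U].
Proof.
have hA := gram_hermitian K; have uP := spectral_unitarymx (K ^t* *m K).
have := spectral_decomp_dgm hA.
set lam := fun i => complex.Re _; set P := spectralmx _ in uP *.
have lam0 i : 0 <= lam i.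
  have := gram_spectral_ge0 K i; rewrite /lam => h0.
  by rewrite -lecR RRe_real // ger0_real.
move=> AE; pose t := [tuple lam i | i < d].
have : perm_eq (sort (fun x y => y <= x) t) t by rewrite perm_sort.
move=> /tuple_permP[s sE].
have ts : sorted (fun x y => y <= x) [tuple tnth t (s i) | i < d].
  by rewrite -sE; apply: sort_sorted => x y; exact: le_total.
exists (perm_mx s *m P), (lam \o s); split.
- exact: mul_unitarymx (perm_mx_unitary R s) uP.
- by move=> i; exact: lam0.
- move=> i j ij; pose T := [tuple tnth t (s i) | i < d].
  have tT k : tnth T k = lam (s k) by rewrite !tnth_mktuple.
  rewrite /= -!tT !(tnth_nth 0).
  apply: (sorted_leq_nth _ _ 0 ts) => //; rewrite ?inE ?size_tuple //.
  by move=> y x z /= yx zy; exact: le_trans yx.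
- rewrite dgm_perm {1}AE trmxC_mul tr_perm_mx map_perm_mx -!mulmxA.
  rewrite (mulmxA (perm_mx s^-1) (perm_mx s) P) -perm_mxM mulVg perm_mx1 mul1mx.
  rewrite (mulmxA (perm_mx s^-1) (perm_mx s)) -perm_mxM mulVg perm_mx1.
  by rewrite mul1mx.
Qed.

Lemma posdefmx_decomp (A : 'M[R[i]]_d) : posdefmx A ->
  exists U a, [/\ U \is unitarymx, forall i, 0 < a i &
    A = U ^t* *m dgm a *m U].
Proof.
move=> [/hermsymmxP hA pA]; have uP := spectral_unitarymx A.
exists (spectralmx A), (fun i => complex.Re (spectral_diag A 0 i)).
split=> //; last exact: spectral_decomp_dgm.
move=> i; set P := spectralmx A in uP *.
pose x := P ^t* *m delta_mx i 0 : 'cV[R[i]]_d.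
have Px : P *m x = delta_mx i 0.
  by rewrite /x mulmxA (unitarymxP uP) mul1mx.
have x0 : x != 0.
  apply/eqP => x0; have /matrixP/(_ i 0) := Px.
  by rewrite x0 mulmx0 !mxE !eqxx => /esym/eqP; rewrite oner_eq0.
have := pA x x0; rewrite {1}(spectral_decomp_dgm hA) -/P.
rewrite !mulmxA -trmxC_mul Px -!mulmxA Px.
rewrite mul_diag_mx mxE (bigD1 i) //= big1 ?addr0.
  by rewrite !mxE !eqxx conjC1 mul1r mulr1 ltcR.
by move=> j /negPf ji; rewrite !mxE ji mulr0 mulr0.
Qed.

Section Power.
Variables (A : 'M[R[i]]_d).
Hypothesis pA : posdefmx A.

Lemma mxpow_hermitian u : (mxpow A u) ^t* = mxpow A u.
Proof.
have [U [a [uU a0 ->]]] := posdefmx_decomp pA.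
by rewrite /mxpow (mxfun_conj_dgm _ _ uU) dgm_conj_hermitian.
Qed.

Lemma mxpowD u w : mxpow A (u + w) = mxpow A u *m mxpow A w.
Proof.
have [U [a [uU a0 ->]]] := posdefmx_decomp pA.
rewrite /mxpow !(mxfun_conj_dgm _ _ uU) (dgm_conjM _ _ uU).
apply: conj_dgm_ext => i /=.
by rewrite powRD // (gt_eqF (a0 i)) implybT.
Qed.

Lemma mxpow0 : mxpow A 0 = 1%:M.
Proof.
have [U [a [uU a0 ->]]] := posdefmx_decomp pA.
rewrite /mxpow (mxfun_conj_dgm _ _ uU) (@conj_dgm_ext _ _ (fun=> 1)).
  by rewrite dgm1 mulmx1 unitarymx_VK.
by move=> i /=; rewrite powRr0.
Qed.

Lemma mxpow1 : mxpow A 1 = A.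
Proof.
have [U [a [uU a0 ->]]] := posdefmx_decomp pA.
rewrite /mxpow (mxfun_conj_dgm _ _ uU); apply: conj_dgm_ext => i /=.
by rewrite powRr1 // ltW.
Qed.

Lemma mxpowNr u : mxpow A (- u) *m mxpow A u = 1%:M.
Proof. by rewrite -mxpowD addNr mxpow0. Qed.

Lemma mxpow_unitmx u : mxpow A u \in unitmx.
Proof. by case: (mulmx1_unit (mxpowNr u)). Qed.

Lemma mxpowN1 : mxpow A (- 1) = invmx A.
Proof.
have uA : A \in unitmx by rewrite -{1}mxpow1 mxpow_unitmx.
by rewrite -[LHS](mulmxK uA) -{2}mxpow1 mxpowNr mul1mx.
Qed.

End Power.

End FunctionalCalculus.

(** * Log-convexity and boundedness of the scaled norms *)

Section LogConvexity.
Variables (R : realType) (d : nat) (nrm : 'M[R[i]]_d -> R).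
Hypothesis nrmP : unitarily_invariant_norm nrm.
Variable t : R.
Hypothesis t0 : 0 < t.
Local Open Scope sesquilinear_scope.

(** By unitary invariance the norm only sees the eigenvalues; the factor
1/2 in the exponent is the square root in |Y|. *)
Lemma nrm_mxabs_pow (Y U : 'M[R[i]]_d) (a : 'I_d -> R) : U \is unitarymx ->
  Y ^t* *m Y = U ^t* *m dgm a *m U ->
  nrm (mxpow (mxabs Y) t) = gauge nrm (fun i => a i `^ (2^-1 * t)).
Proof.
move=> uU YE; rewrite /mxabs YE /mxpow !(mxfun_conj_dgm _ _ uU).
rewrite (uinormU nrmP) ?trmxC_unitary // /gauge; congr (nrm (dgm _)).
by apply/funext=> i /=; rewrite powRrM.
Qed.

Lemma prodr_powR (I : finType) (P : pred I) (a : I -> R) (s : R) :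
  (forall i, 0 <= a i) ->
  \prod_(i | P i) a i `^ s = (\prod_(i | P i) a i) `^ s.
Proof.
move=> a0; suff [] : \prod_(i | P i) a i `^ s = (\prod_(i | P i) a i) `^ s
  /\ 0 <= \prod_(i | P i) a i by [].
apply: (big_ind2 (fun x y => x = y `^ s /\ 0 <= y)).
- by rewrite powR1.
- by move=> x1 x2 y1 y2 [-> x0] [-> y0]; rewrite powRM // mulr_ge0.
- by move=> i _.
Qed.

(** Raised to the power s = t / 2, the inequalities between products of
eigenvalues say that the eigenvalues of |Y|^t are weakly log-majorized by the
geometric means z of those of |P|^t and |Q|^t. *)
Lemma nrm_mxabs_pow_CauchySchwarz (Y P Q D : 'M[R[i]]_d) : D \in unitmx ->
  P ^t* *m Q *m D = D *m (Y ^t* *m Y) ->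
  nrm (mxpow (mxabs Y) t) ^+ 2
  <= nrm (mxpow (mxabs P) t) * nrm (mxpow (mxabs Q) t).
Proof.
move=> uD PQ.
have [UY [l [uUY l0 ld YE]]] := sorted_gram_decomp Y.
have [UP [a [uUP a0 ad PE]]] := sorted_gram_decomp P.
have [UQ [b [uUQ b0 bd QE]]] := sorted_gram_decomp Q.
(* From here on, all that matters about F is its value in terms of the
   eigenvalues. *)
pose F Z := nrm (mxpow (mxabs Z) t); have FE := nrm_mxabs_pow.
change (F Y ^+ 2 <= F P * F Q).
have {}FE Z U c : U \is unitarymx -> Z ^t* *m Z = U ^t* *m dgm c *m U ->
  F Z = gauge nrm (fun i => c i `^ (2^-1 * t)) := @nrm_mxabs_pow Z U c.
clearbody F; rewrite (FE _ _ _ uUY YE) (FE _ _ _ uUP PE) (FE _ _ _ uUQ QE).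
set s := 2^-1 * t; have s0 : 0 <= s by rewrite mulr_ge0 // ltW.
pose z i := Num.sqrt (a i `^ s * b i `^ s).
have zE i : z i ^+ 2 = a i `^ s * b i `^ s.
  by rewrite sqr_sqrtr // mulr_ge0 // powR_ge0.
apply: (@le_trans _ _ (gauge nrm z ^+ 2)); last first.
  apply: gauge_CauchySchwarz => // i; rewrite ?powR_ge0 //.
  exact: sqrtr_ge0.
rewrite ler_sqr ?nnegrE ?gauge_ge0 //.
apply: gauge_weak_log_majorization => //.
- by move=> i; exact: powR_ge0.
- by move=> i; exact: sqrtr_ge0.
- by move=> i j ij; rewrite ge0_ler_powR // ?nnegrE // ld.
move=> k kd.
rewrite -ler_sqr ?nnegrE ?prodr_ge0 //; last first.
- by move=> i _; exact: sqrtr_ge0.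
- by move=> i _; exact: powR_ge0.
rewrite [leRHS]expr2 -big_split /=.
rewrite [leRHS](eq_bigr (fun i => a i `^ s * b i `^ s)).
  rewrite [leRHS]big_split /= !prodr_powR // -[leRHS]powRM ?prodr_ge0 //.
  rewrite [leLHS]expr2 -powRM ?prodr_ge0 //.
  apply: ge0_ler_powR; rewrite ?nnegrE ?mulr_ge0 ?prodr_ge0 ?(ltW t0) //.
  rewrite -lecR !rmorphM /= !rmorph_prod -expr2.
  have C0 (c : 'I_d -> R) : (forall i, 0 <= c i) -> forall i, 0 <= (c i)%:C.
    by move=> c0 i; rewrite ler0c.
  have Cd (c : 'I_d -> R) : (forall i j : 'I_d, (i <= j)%N -> c j <= c i) ->
      forall i j : 'I_d, (i <= j)%N -> (c j)%:C <= (c i)%:C.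
    by move=> cd i j ij; rewrite lecR cd.
  exact: (singular_value_product uD PQ uUY uUP uUQ YE PE QE (C0 _ l0) (C0 _ a0)
    (C0 _ b0) (Cd _ ad) (Cd _ bd) kd).
by move=> i _; rewrite -expr2 zE.
Qed.

(** The structure of the powers of a positive definite matrix from which
log-convexity follows. *)
Definition hermitian_group (S : R -> 'M[R[i]]_d) :=
  [/\ forall u, (S u) ^t* = S u, forall u w, S (u + w) = S u *m S w &
    S 0 = 1%:M].

Lemma mxpow_hermitian_group (A : 'M[R[i]]_d) : posdefmx A ->
  hermitian_group (mxpow A).
Proof.
move=> pA; split; [exact: mxpow_hermitian | exact: mxpowD | exact: mxpow0].
Qed.

Definition scaled_norm (S T : R -> 'M[R[i]]_d) (X : 'M[R[i]]_d) u : R :=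
  nrm (mxpow (mxabs (S u *m X *m T u)) t).

Lemma scaled_normE S T X u A B : S u = A -> T u = B ->
  scaled_norm S T X u = nrm (mxpow (mxabs (A *m X *m B)) t).
Proof. by rewrite /scaled_norm => -> ->. Qed.

(** The two outer matrices are S h Y T h and S (- h) Y T (- h), where Y is the
middle one; the factors S cancel in the product of the first adjoint with the
second matrix, which is then conjugate to Y* Y by T h. *)
Lemma scaled_norm_midpoint (S T : R -> 'M[R[i]]_d) X x y :
  hermitian_group S -> hermitian_group T ->
  scaled_norm S T X ((x + y) / 2) ^+ 2
  <= scaled_norm S T X x * scaled_norm S T X y.
Proof.
move=> [hS SD S0] [hT TD T0]; rewrite /scaled_norm.
pose m := (x + y) / 2; pose h := (x - y) / 2.
have xE : x = m + h by rewrite /m /h; lra.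
have yE : y = m - h by rewrite /m /h; lra.
have TV : T (- h) *m T h = 1%:M by rewrite -TD addNr T0.
have SV : S h *m S (- h) = 1%:M by rewrite -SD subrr S0.
have [_ uT] := mulmx1_unit TV.
apply: (nrm_mxabs_pow_CauchySchwarz uT); rewrite -/m.
have Px : S x *m X *m T x = S h *m (S m *m X *m T m) *m T h.
  by rewrite [in S x]xE [in T x]xE (addrC m) SD (addrC h) TD !mulmxA.
have Py : S y *m X *m T y = S (- h) *m (S m *m X *m T m) *m T (- h).
  by rewrite [in S y]yE [in T y]yE (addrC m) SD (addrC (- h)) TD !mulmxA.
rewrite Px Py; move: (S m *m X *m T m) => Y.
rewrite !trmxC_mul hS hT -!mulmxA TV mulmx1.
by rewrite (mulmxA (S h)) SV mul1mx.
Qed.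

Lemma powR_le_add_inv (a u : R) : 0 < a -> -1 <= u <= 1 ->
  a `^ u <= a + a^-1.
Proof.
move=> a0 /andP[u1 u2]; have [a1|a1] := leP 1 a.
  apply: le_trans (ler_powR a1 u2) _.
  by rewrite powRr1 ?(ltW a0) // lerDl invr_ge0 ltW.
have : a `^ u <= a `^ (-1) by apply: ger_powR => //; rewrite a0 ltW.
by rewrite powRN powRr1 ?(ltW a0) // => /le_trans; apply; rewrite lerDr ltW.
Qed.

Lemma dgm_sandwichE (x y : 'I_d -> R) (Z : 'M[R[i]]_d) i j :
  (dgm x *m Z *m dgm y) i j = (x i)%:C * Z i j * (y j)%:C.
Proof. by rewrite mul_mx_diag mxE mul_diag_mx !mxE. Qed.

Lemma mulmx_regroup (P X Q D E : 'M[R[i]]_d) :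
  P ^t* *m D *m P *m X *m (Q ^t* *m E *m Q)
  = P ^t* *m (D *m (P *m X *m Q ^t*) *m E) *m Q.
Proof. by rewrite !mulmxA. Qed.

(** Unitary invariance of the Frobenius norm. *)
Lemma mxtrace_gram_unitary (P Q T : 'M[R[i]]_d) :
  P \is unitarymx -> Q \is unitarymx ->
  \tr ((P ^t* *m T *m Q) ^t* *m (P ^t* *m T *m Q))
  = \sum_i \sum_j `|T j i| ^+ 2.
Proof.
move=> uP uQ; rewrite !trmxC_mul trmxCK -!mulmxA mxtrace_mulC -!mulmxA.
rewrite (unitarymxP uQ) mulmx1 (mulmxA P) (unitarymxP uP) mul1mx.
by apply: eq_bigr => i _; rewrite gram_diagE.
Qed.

(** Every eigenvalue of Y* Y is at most its trace, the squared Frobenius norm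
of Y.  In the eigenbases of A and B that norm is an explicit sum in which u
only occurs in the powers of the eigenvalues, each bounded by
[powR_le_add_inv]. *)
Lemma scaled_norm_bounded (A B X : 'M[R[i]]_d) : posdefmx A -> posdefmx B ->
  exists M, forall u, -1 <= u <= 1 ->
    scaled_norm (mxpow A) (mxpow B) X u <= M.
Proof.
move=> pA pB.
have [P [a [uP a0 AE]]] := posdefmx_decomp pA.
have [Q [b [uQ b0 BE]]] := posdefmx_decomp pB.
pose Z := P *m X *m Q ^t*.
pose z i j : R := Num.sqrt (complex.Re (Z i j) ^+ 2 + complex.Im (Z i j) ^+ 2).
have zE i j : `|Z i j| = (z i j)%:C by rewrite normc_def.
pose L := \sum_i \sum_j ((a i + (a i)^-1) * (b j + (b j)^-1) * z i j) ^+ 2.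
exists (L `^ (2^-1 * t) * gauge nrm (fun=> 1)) => u u1.
pose T := dgm (fun i => a i `^ u) *m Z *m dgm (fun j => b j `^ u).
have YE : mxpow A u *m X *m mxpow B u = P ^t* *m T *m Q.
  rewrite AE BE /mxpow (mxfun_conj_dgm _ _ uP) (mxfun_conj_dgm _ _ uQ).
  exact: mulmx_regroup.
have [U [l [uU l0 _ lE]]] := sorted_gram_decomp (P ^t* *m T *m Q).
rewrite /scaled_norm YE (nrm_mxabs_pow uU lE).
have trl : \sum_i l i = \sum_i \sum_j (a j `^ u * b i `^ u * z j i) ^+ 2.
  apply: complexI; rewrite !rmorph_sum /=.
  have -> : \sum_i (l i)%:C = \tr (U ^t* *m dgm l *m U).
    rewrite mxtrace_mulC mulmxA (unitarymxP uU) mul1mx.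
    by apply: eq_bigr => i _; rewrite dgmE eqxx.
  rewrite -lE mxtrace_gram_unitary //; apply: eq_bigr => i _.
  rewrite rmorph_sum; apply: eq_bigr => j _.
  rewrite /T dgm_sandwichE !normrM zE.
  rewrite !ger0_norm ?ler0c ?powR_ge0 // rmorphXn /= !rmorphM /=.
  by rewrite mulrAC.
have lL i : l i <= L.
  apply: (@le_trans _ _ (\sum_i l i)).
    by rewrite (bigD1 i) //= lerDl sumr_ge0.
  rewrite trl exchange_big /=; apply: ler_sum => p _; apply: ler_sum => q _.
  have z0 : 0 <= z p q by exact: sqrtr_ge0.
  rewrite ler_sqr ?nnegrE ?mulr_ge0 ?addr_ge0 ?powR_ge0 ?invr_ge0 ?(ltW (a0 _))
    ?(ltW (b0 _)) // ler_wpM2r // ler_pM ?powR_ge0 ?powR_le_add_inv //.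
rewrite -(gaugeZ nrmP) ?powR_ge0 //; apply: gauge_le => // i.
rewrite powR_ge0 mulr1 /= ge0_ler_powR ?nnegrE //.
  by rewrite mulr_ge0 // ltW.
exact: le_trans (l0 i) (lL i).
Qed.

End LogConvexity.

(** * Bounded midpoint convex functions and dyadic chords *)

Section Convexity.
Variable R : realType.

(** Every point of [0, 1] is the midpoint of an end point, where h vanishes, and
of another point of [0, 1]; hence a bound M on h can be halved, and then
halved again indefinitely. *)
Lemma midconvex_unit_le0 (h : R -> R) (M : R) :
  (forall x y, 0 <= x <= 1 -> 0 <= y <= 1 ->
     2 * h ((x + y) / 2) <= h x + h y) ->
  (forall x, 0 <= x <= 1 -> h x <= M) ->
  h 0 = 0 -> h 1 = 0 -> forall x, 0 <= x <= 1 -> h x <= 0.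
Proof.
move=> hm hM h0 h1.
have half n x : 0 <= x <= 1 -> 2 ^+ n * h x <= M.
  elim: n x => [|n IH] x x01; first by rewrite expr0 mul1r hM.
  have [xl|xg] := leP x 2^-1.
    have := hm 0 (2 * x); rewrite h0 !add0r.
    have -> : 2 * x / 2 = x by lra.
    have x2 : 0 <= 2 * x <= 1 by lra.
    rewrite lexx ler01 => /(_ isT x2) le.
    apply: le_trans (IH _ x2); rewrite exprSr -mulrA.
    by rewrite ler_pM2l ?exprn_gt0.
  have := hm 1 (2 * x - 1); rewrite h1 add0r.
  have -> : (1 + (2 * x - 1)) / 2 = x by lra.
  have x2 : 0 <= 2 * x - 1 <= 1 by lra.
  rewrite lexx ler01 => /(_ isT x2) le.
  apply: le_trans (IH _ x2); rewrite exprSr -mulrA.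
  by rewrite ler_pM2l ?exprn_gt0.
move=> x x01; rewrite leNgt; apply/negP => hx.
pose n := Num.bound `|M / h x|.
have := half n x x01; rewrite -ler_pdivlMr // leNgt => /negP; apply.
exact: le_lt_trans (ler_norm _) (upper_nthrootP (leqnn _)).
Qed.

(** [midconvex_unit_le0] applied to the difference between f and its chord. *)
Lemma midconvex_bounded_le (f : R -> R) (l r M : R) : l <= r ->
  (forall x y, l <= x <= r -> l <= y <= r ->
     2 * f ((x + y) / 2) <= f x + f y) ->
  (forall x, l <= x <= r -> f x <= M) ->
  forall a b z, l <= a <= r -> l <= b <= r -> 0 <= z <= 1 ->
  f ((1 - z) * a + z * b) <= (1 - z) * f a + z * f b.
Proof.
move=> lr fm fM a b z alr blr z01.
pose g x := (1 - x) * a + x * b.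
have gin x : 0 <= x <= 1 -> l <= g x <= r.
  by move=> x01; rewrite /g; apply/andP; split; nra.
pose h x := f (g x) - ((1 - x) * f a + x * f b).
suff : h z <= 0 by rewrite /h subr_le0.
apply: (@midconvex_unit_le0 h (M + `|f a| + `|f b|)) => //.
- move=> x y x01 y01; have := fm _ _ (gin x x01) (gin y y01).
  rewrite /h; have -> : (g x + g y) / 2 = g ((x + y) / 2) by rewrite /g; lra.
  lra.
- move=> x x01; rewrite /h; have := fM _ (gin x x01).
  have := ler_norm (f a); have := ler_norm (- f a); rewrite normrN.
  have := ler_norm (f b); have := ler_norm (- f b); rewrite normrN.
  have := normr_ge0 (f a); have := normr_ge0 (f b).
  nra.
- by rewrite /h /g subr0 !mul1r !mul0r !addr0 subrr.
- by rewrite /h /g subrr !mul1r !mul0r !add0r subrr.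
Qed.

(** In the variable w = (v + 1) / 2 the breakpoints are k / 2^n, also for
n = 0, where the exponent n - 1 is negative. *)
Lemma dyadicE n k : dyadic R n k = 2 * (k%:R / 2 ^+ n) - 1.
Proof.
rewrite /dyadic expfzDr ?pnatr_eq0 // -exprnP exprN1 invfM invrK.
by rewrite (mulrC 2) mulrA.
Qed.

(** Linear interpolation of f between two consecutive breakpoints of level n,
evaluated at 2 w - 1: the two weights add up to 1, and both are nonnegative
exactly when w lies in [k / 2^n, (k + 1) / 2^n]. *)
Definition chord (f : R -> R) n k (w : R) :=
  (k.+1%:R - 2 ^+ n * w) * f (dyadic R n k)
  + (2 ^+ n * w - k%:R) * f (dyadic R n k.+1).

(** The open intervals of level n are disjoint, so at most one term survives; at
their end points none does, but there the tent function r vanishes. *)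
Lemma delta_sum_collapse (f : R -> R) n k (w : R) :
  (k < 2 ^ n)%N -> k%:R <= 2 ^+ n * w <= k.+1%:R ->
  let r := Num.min (2 ^+ n * w - k%:R) (k.+1%:R - 2 ^+ n * w) in
  r * (\sum_(1 <= j < (2 ^ n).+1)
    delta_ f n j * \1_(`]dyadic R n j.-1, dyadic R n j[%classic) (2 * w - 1))
  = r * delta_ f n k.+1.
Proof.
move=> kn kw r; have [->|r0] := eqVneq r 0; first by rewrite !mul0r.
congr (_ * _).
have kw1 : k%:R < 2 ^+ n * w < k.+1%:R.
  have : 0 < r by rewrite lt0r r0 /r le_min; lra.
  by rewrite /r lt_min; lra.
have p0 : 0 < 2 ^+ n :> R by rewrite exprn_gt0.
have inE j : (2 * w - 1 \in `]dyadic R n j, dyadic R n j.+1[) =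
    (j%:R < 2 ^+ n * w < j.+1%:R).
  rewrite in_itv /= !dyadicE !ltrD2r !ltr_pM2l //.
  by rewrite ltr_pdivrMr // ltr_pdivlMr // (mulrC w).
rewrite big_add1 /= big_mkord (bigD1 (Ordinal kn)) //= big1 ?addr0.
  by rewrite indicE mem_setE inE kw1 mulr1.
move=> j /eqP jk; rewrite indicE mem_setE inE.
have [|_] := boolP (_ < _ < _); last by rewrite mulr0.
move=> /andP[j1 j2]; exfalso; apply: jk; apply/val_inj => /=.
case/andP: kw1 => k1 k2.
have := lt_trans j1 k2; have := lt_trans k1 j2; rewrite !ltr_nat !ltnS => a b.
by apply/eqP; rewrite eqn_leq a b.
Qed.

(** Going from level n to n + 1 replaces the chord over one dyadic interval by
the chord over one of its halves.  The two differ by the second difference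
delta at the midpoint times the tent function of the interval, which is r_n;
so the sum telescopes. *)
Lemma dyadic_refinement (f : R -> R) n (w : R) : 0 <= w <= 1 ->
  exists k, [/\ (k < 2 ^ n)%N, k%:R <= 2 ^+ n * w <= k.+1%:R,
    r_ n w = Num.min (2 ^+ n * w - k%:R) (k.+1%:R - 2 ^+ n * w) &
    \sum_(0 <= m < n) r_ m w * \sum_(1 <= j < (2 ^ m).+1)
      delta_ f m j * \1_(`]dyadic R m j.-1, dyadic R m j[%classic) (2 * w - 1)
    = (1 - w) * f (-1) + w * f 1 - chord f n k w].
Proof.
move=> w01; elim: n => [|n [k [kn kw rw sw]]].
  exists 0%N; rewrite expr0 mul1r subr0; split => //.
  rewrite big_nil /chord !dyadicE expr0 !divr1 !mul1r subr0.
  by rewrite mulr0 add0r mulr1 addrK subrr.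
have p0 : 0 < 2 ^+ n :> R by rewrite exprn_gt0.
have dyl : dyadic R n.+1 k.*2 = dyadic R n k.
  rewrite !dyadicE -muln2 natrM exprSr invfM mulrACA divff ?mulr1 //.
have dyr : dyadic R n.+1 k.*2.+2 = dyadic R n k.+1.
  rewrite !dyadicE -doubleS -muln2 natrM exprSr invfM mulrACA divff ?mulr1 //.
have dym : (2 * k.+1%:R - 1) / 2 ^+ n - 1 = dyadic R n.+1 k.*2.+1.
  rewrite dyadicE exprS -[k.*2.+1%:R]natr1 -muln2 natrM -[k.+1%:R]natr1.
  by field; rewrite gt_eqF.
have step b : \sum_(0 <= m < n.+1) r_ m w * \sum_(1 <= j < (2 ^ m).+1)
      delta_ f m j * \1_(`]dyadic R m j.-1, dyadic R m j[%classic) (2 * w - 1)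
    = b <-> (1 - w) * f (-1) + w * f 1 - (chord f n k w
      - r_ n w * delta_ f n k.+1) = b.
  rewrite big_nat_recr //= sw rw delta_sum_collapse // -rw opprB.
  by rewrite addrA addrAC.
rewrite /= rw; set y := 2 ^+ n * w in kw rw *.
have yS : 2 ^+ n.+1 * w = 2 * y by rewrite exprS /y mulrA.
have kS : k.+1%:R = k%:R + 1 :> R by rewrite -natr1.
have k2 : k.*2%:R = 2 * k%:R :> R by rewrite -muln2 natrM mulrC.
have k2S : k.*2.+1%:R = 2 * k%:R + 1 :> R by rewrite -natr1 k2.
have k2SS : k.*2.+2%:R = 2 * k%:R + 2 :> R by rewrite -natr1 k2S; lra.
have [yl|yr] := leP (2 * y) (2 * k%:R + 1).
- exists k.*2; rewrite yS k2 k2S; split.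
  + by rewrite expnS mul2n ltn_double.
  + lra.
  + rewrite kS (_ : Num.min _ (_ - y) = y - k%:R).
      by congr (Num.min _ _); lra.
    by apply/min_idPl; lra.
  + apply/step; congr (_ - _).
    rewrite /chord /delta_ dyl dym -/y yS rw k2 k2S.
    rewrite kS (_ : Num.min _ (_ - y) = y - k%:R); last by apply/min_idPl; lra.
    rewrite /=; ring.
- exists k.*2.+1; rewrite yS k2S k2SS; split.
  + by rewrite expnS mul2n ltn_Sdouble.
  + lra.
  + rewrite kS (_ : Num.min _ (_ - y) = k%:R + 1 - y).
      by rewrite minC; congr (Num.min _ _); lra.
    by apply/min_idPr; lra.
  + apply/step; congr (_ - _).
    rewrite /chord /delta_ dyr dym -/y yS rw k2S k2SS.
    rewrite kS (_ : Num.min _ (_ - y) = k%:R + 1 - y); last first.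
      by apply/min_idPr; lra.
    rewrite /=; ring.
Qed.

Lemma midconvex_refinement (f : R -> R) (M : R) N (v : R) :
  (forall x y, -1 <= x <= 1 -> -1 <= y <= 1 ->
     2 * f ((x + y) / 2) <= f x + f y) ->
  (forall x, -1 <= x <= 1 -> f x <= M) ->
  f (-1) = f 1 -> -1 <= v <= 1 ->
  f v <= f 1 - \sum_(0 <= n < N) s_ n v * \sum_(1 <= k < (2 ^ n).+1)
           delta_ f n k * \1_(`]dyadic R n k.-1, dyadic R n k[%classic) v.
Proof.
move=> fm fM fE v1; pose w := (v + 1) / 2.
have w01 : 0 <= w <= 1 by rewrite /w; lra.
have vE : v = 2 * w - 1 by rewrite /w; lra.
have [k [kn kw _]] := dyadic_refinement f N w01.
rewrite -vE => ->; rewrite fE opprB addrCA -mulrDl subrK mul1r subrr addr0.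
have lr : -1 <= 1 :> R by lra.
have p0 : 0 < 2 ^+ N :> R by rewrite exprn_gt0.
have kS : k.+1%:R = k%:R + 1 :> R by rewrite -natr1.
have dy j : (j <= 2 ^ N)%N -> -1 <= dyadic R N j <= 1.
  move=> jN; rewrite dyadicE.
  have : 0 <= j%:R / 2 ^+ N :> R by rewrite divr_ge0 // ltW.
  have : j%:R / 2 ^+ N <= 1 :> R by rewrite ler_pdivrMr // mul1r -natrX ler_nat.
  lra.
have := @midconvex_bounded_le f (-1) 1 M lr fm fM (dyadic R N k)
  (dyadic R N k.+1) (2 ^+ N * w - k%:R) (dy _ (ltnW kn)) (dy _ kn).
rewrite /chord kS; set z := _ - k%:R.
have -> : (1 - z) * dyadic R N k + z * dyadic R N k.+1 = v.
  by rewrite vE !dyadicE kS /z; field; rewrite gt_eqF.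
have -> : k%:R + 1 - 2 ^+ N * w = 1 - z by rewrite /z; lra.
by apply; rewrite /z; lra.
Qed.
Lemma log_midpoint_le (a b c : R) :
  0 <= a -> 0 <= b -> 0 <= c -> c ^+ 2 <= a * b -> 2 * c <= a + b.
Proof.
move=> a0 b0 c0 cab; rewrite -ler_sqr ?nnegrE ?addr_ge0 ?mulr_ge0 //.
by have := sqr_ge0 (a - b); nra.
Qed.

(** With f u = g u * g (- u), the values f 1 and f (-1) coincide, so the chord
of f over [-1, 1] is constant. *)
Lemma log_midconvex_symmetric_refinement (g : R -> R) (M p q : R) N (v : R) :
  (forall u, 0 <= g u) ->
  (forall x y, g ((x + y) / 2) ^+ 2 <= g x * g y) ->
  (forall u, -1 <= u <= 1 -> g u <= M) ->
  g 1 = p -> g (-1) = q -> -1 <= v <= 1 ->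
  let f u := g u * g (- u) in
  g v * g (- v)
  <= p * q - \sum_(0 <= n < N) s_ n v * \sum_(1 <= k < (2 ^ n).+1)
           delta_ f n k * \1_(`]dyadic R n k.-1, dyadic R n k[%classic) v.
Proof.
move=> g0 gm gM <- <- v1.
apply: (@midconvex_refinement (fun u => g u * g (- u)) (M * M)) => //.
- move=> x y _ _; have := gm x y; have := gm (- x) (- y).
  rewrite -opprD mulNr; set m := (x + y) / 2 => m1 m2.
  apply: log_midpoint_le; rewrite ?mulr_ge0 // exprMn [leRHS]mulrACA.
  by apply: ler_pM; rewrite ?exprn_ge0.
- by move=> x x1; apply: ler_pM => //; apply: gM => //; lra.
- by rewrite opprK mulrC.
Qed.

End Convexity.

(** * The refined inequality *)

Theorem theorem17 (R : realType) (d : nat) (A B X : 'M[R[i]]_d)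
    (nrm : 'M[R[i]]_d -> R) (N : nat) (t v : R) :
  posdefmx A -> posdefmx B -> unitarily_invariant_norm nrm ->
  0 < t -> -1 <= v <= 1 ->
  let f u := nrm (mxpow (mxabs (mxpow A u *m X *m mxpow B u)) t)
             * nrm (mxpow (mxabs (mxpow A (- u) *m X *m mxpow B (- u))) t) in
  nrm (mxpow (mxabs (mxpow A v *m X *m mxpow B v)) t)
  * nrm (mxpow (mxabs (mxpow A (- v) *m X *m mxpow B (- v))) t)
  <= nrm (mxpow (mxabs (A *m X *m B)) t)
     * nrm (mxpow (mxabs (invmx A *m X *m invmx B)) t)
     - \sum_(0 <= n < N) s_ n v *
         \sum_(1 <= k < (2 ^ n).+1)
           delta_ f n k * \1_(`]dyadic R n k.-1, dyadic R n k[%classic) v.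
Proof.
move=> pA pB nrmP t0 v1.
have [M gM] := scaled_norm_bounded nrmP t0 X pA pB.
have gm x y := scaled_norm_midpoint nrmP t0 X x y
  (mxpow_hermitian_group pA) (mxpow_hermitian_group pB).
exact: (@log_midconvex_symmetric_refinement R
  (scaled_norm nrm t (mxpow A) (mxpow B) X) M _ _ N v
  (fun u => uinorm_ge0 nrmP _) gm gM
  (scaled_normE nrm t X (mxpow1 pA) (mxpow1 pB))
  (scaled_normE nrm t X (mxpowN1 pA) (mxpowN1 pB)) v1).
Qed.
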